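(* Let $K$ be a field and let $\phi:\mathfrak g\to\mathfrak h$ and $\psi:\mathfrak h\to\mathfrak l$ be homomorphisms of Lie algebras over $K$. Then: (1) $\operatorname{cd}(\phi)\le\min\{\operatorname{cd}(\mathfrak g),\operatorname{cd}(\mathfrak h)\}$; (2) $\operatorname{cd}(\operatorname{id}_{\mathfrak g})=\operatorname{cd}(\mathfrak g)$; (3) $\operatorname{cd}(\psi\circ\phi)\le\min\{\operatorname{cd}(\phi),\operatorname{cd}(\psi)\}$.
   Context: Lie algebras are over a field $K$ and may be infinite-dimensional. Modules over a Lie algebra $\mathfrak g$ are left $\mathfrak g$-modules, equivalently left modules over the universal enveloping algebra $U(\mathfrak g)$ (no finiteness assumption). $H^n(\mathfrak g,M)$ denotes Chevalley--Eilenberg cohomology (equivalently $\operatorname{Ext}^n_{U(\mathfrak g)}(K,M)$). The cohomological dimension $\operatorname{cd}(\mathfrak g)$ is the maximal integer $n$ such that $H^n(\mathfrak g,M)\ne 0$ for some $\mathfrak g$-module $M$ ($\infty$ if no maximum exists). For a Lie algebra homomorphism $\phi:\mathfrak g\to\mathfrak h$ and an $\mathfrak h$-module $M$, regarded as a $\mathfrak g$-module by restriction along $\phi$, there is an induced map $\phi^*:H^n(\mathfrak h,M)\to H^n(\mathfrak g,M)$ for each $n\ge 0$. The cohomological dimension of $\phi$ is $$\operatorname{cd}(\phi)=\sup\{n\ge 0:\ \text{there is an }\mathfrak h\text{-module }M\text{ with }\phi^*:H^n(\mathfrak h,M)\to H^n(\mathfrak g,M)\text{ nonzero}\},$$ a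 value in $\{0,1,2,\dots\}\cup\{\infty\}$. *)

(* Defs.v *)
From HB Require Import structures.
From mathcomp Require Import all_boot all_order all_algebra.
From mathcomp Require Import ring_quotient generic_quotient.
From mathcomp Require Import boolp classical_sets functions constructive_ereal.

Set Implicit Arguments.
Unset Strict Implicit.
Unset Printing Implicit Defensive.

Import Order.TTheory GRing.Theory Num.Theory.
Local Open Scope ring_scope.

HB.mixin Record isLieAlgebra (K : fieldType) g of GRing.Lmodule K g := {
  lie : g -> g -> g;
  lie_linearl : forall y, linear (lie^~ y);
  lie_linearr : forall x, linear (lie x);
  liexx : forall x, lie x x = 0;
  lie_jacobi : forall x y z,
    lie x (lie y z) + lie y (lie z x) + lie z (lie x y) = 0
}.

#[short(type="lieAlgType")]
HB.structure Definition LieAlgebra (K : fieldType) :=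
  {g of GRing.Lmodule K g & isLieAlgebra K g}.

HB.mixin Record isLieMorphism (K : fieldType) (g h : lieAlgType K)
    (f : g -> h) := {
  lie_morph : {morph f : x y / lie x y >-> lie x y}
}.

HB.structure Definition LieMorphism (K : fieldType) (g h : lieAlgType K) :=
  {f of @GRing.Linear K g h *:%R f & isLieMorphism K g h f}.

Notation "{ 'lie' g -> h }" := (LieMorphism.type g h)
  (at level 0, g at level 98, h at level 99,
   format "{ 'lie'  g  ->  h }") : type_scope.

Fact idfun_lie_morph (K : fieldType) (g : lieAlgType K) :
  {morph (idfun : g -> g) : x y / lie x y >-> lie x y}.
Proof. by []. Qed.

HB.instance Definition _ (K : fieldType) (g : lieAlgType K) :=
  isLieMorphism.Build K g g idfun (@idfun_lie_morph K g).

Fact comp_lie_morph (K : fieldType) (g h l : lieAlgType K)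
    (psi : {lie h -> l}) (phi : {lie g -> h}) :
  {morph psi \o phi : x y / lie x y >-> lie x y}.
Proof. by move=> x y /=; rewrite !lie_morph. Qed.

HB.instance Definition _ (K : fieldType) (g h l : lieAlgType K)
    (psi : {lie h -> l}) (phi : {lie g -> h}) :=
  isLieMorphism.Build K g l (psi \o phi) (comp_lie_morph psi phi).

HB.mixin Record isLieModule (K : fieldType) (g : lieAlgType K) M
    of GRing.Lmodule K M := {
  lact : g -> M -> M;
  lact_linearl : forall m, linear (lact^~ m);
  lact_linearr : forall x, linear (lact x);
  lact_lie : forall x y m,
    lact (lie x y) m = lact x (lact y m) - lact y (lact x m)
}.

#[short(type="lieModType")]
HB.structure Definition LieModule (K : fieldType) (g : lieAlgType K) :=
  {M of GRing.Lmodule K M & isLieModule K g M}.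

Arguments lact {K g s} x m : rename.

HB.instance Definition _ (K : fieldType) (g : lieAlgType K)
    (M : lieModType g) (x : g) :=
  GRing.isLinear.Build K M M _ (@lact K g M x) (lact_linearr x).

Section Restriction.
Variables (K : fieldType) (g h : lieAlgType K).

Definition restr (phi : {lie g -> h}) (M : lieModType h) : Type := M.

Variables (phi : {lie g -> h}) (M : lieModType h).

HB.instance Definition _ := GRing.Lmodule.copy (restr phi M) M.

Definition restr_act (x : g) (m : restr phi M) : restr phi M :=
  lact (phi x) (m : M).

Fact restr_act_linearl m : linear (restr_act^~ m).
Proof.
by move=> a x y; rewrite /restr_act linearP; exact: (lact_linearl (m : M)).
Qed.

Fact restr_act_linearr x : linear (restr_act x).
Proof. by move=> a m m'; exact: (lact_linearr (phi x)). Qed.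

Fact restr_act_lie x y m :
  restr_act (lie x y) m
  = restr_act x (restr_act y m) - restr_act y (restr_act x m).
Proof. by rewrite /restr_act lie_morph; exact: lact_lie. Qed.

HB.instance Definition _ := isLieModule.Build K g (restr phi M)
  restr_act_linearl restr_act_linearr restr_act_lie.

End Restriction.

Section ChevalleyEilenberg.
Variables (K : fieldType) (g : lieAlgType K) (M : lieModType g).

Definition multilinear n (f : ('I_n -> g) -> M) : Prop :=
  forall (v : 'I_n -> g) (i : 'I_n), linear (fun x : g => f (dfwith v (i := i) x)).

(* Vanishing on repeated arguments; in characteristic 2 this is stronger than
   skew-symmetry. *)
Definition alternating n (f : ('I_n -> g) -> M) : Prop :=
  forall (v : 'I_n -> g) (i j : 'I_n), i != j -> v i = v j -> f v = 0.

Definition cochain n (f : ('I_n -> g) -> M) : Prop :=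
  multilinear f /\ alternating f.

Definition fcons n (x : g) (v : 'I_n -> g) : 'I_n.+1 -> g :=
  fun k => if unlift ord0 k is Some k' then v k' else x.

(* sum_i (-1)^i x_i . f(x_0, .., ^x_i, .., x_n) *)
Definition ce_diff_act n (f : ('I_n -> g) -> M) : ('I_n.+1 -> g) -> M :=
  fun v => \sum_(i < n.+1) (-1) ^+ i *: lact (v i) (f (v \o lift i)).

(* sum_(i < j) (-1)^(i + j) f([x_i, x_j], x_0, .., ^x_i, .., ^x_j, .., x_n).
   As i < j, the i-th entry of v \o lift j (v without its j-th entry)
   is v i. *)
Definition ce_diff_lie n : (('I_n -> g) -> M) -> ('I_n.+1 -> g) -> M :=
  match n with
  | 0 => fun _ _ => 0
  | m.+1 => fun f v =>
      \sum_(j < m.+2) \sum_(i < m.+1 | (i < j)%N)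
         (-1) ^+ (i + j)
           *: f (fcons (lie (v (lift j i)) (v j)) (v \o lift j \o lift i))
  end.

Definition ce_diff n (f : ('I_n -> g) -> M) : ('I_n.+1 -> g) -> M :=
  fun v => ce_diff_act f v + ce_diff_lie f v.

Definition cocycle_pred n : {pred (('I_n -> g) -> M)} :=
  fun f => `[< cochain f /\ ce_diff f = 0 >].

Arguments cocycle_pred n : clear implicits.

Record cocycle n := Cocycle {
  cocycle_fun :> ('I_n -> g) -> M;
  _ : cocycle_fun \in cocycle_pred n
}.

HB.instance Definition _ n := [isSub for @cocycle_fun n].
HB.instance Definition _ n := [Choice of cocycle n by <:].

Fact cochain0 n : cochain (0 : ('I_n -> g) -> M).
Proof.
have E v : (0 : ('I_n -> g) -> M) v = 0 by [].
by split=> [v i a x y|//]; rewrite !E scaler0 addr0.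
Qed.

Fact cochainB n (f f' : ('I_n -> g) -> M) :
  cochain f -> cochain f' -> cochain (f - f').
Proof.
have E v : (f - f') v = f v - f' v by [].
move=> [mf af] [mf' af']; split=> [v i a x y|v i j nij vij].
  rewrite !E; have /= -> := mf v i a x y; have /= -> := mf' v i a x y.
  by rewrite scalerBr opprD addrACA.
by rewrite E (af v i j) // (af' v i j) // subr0.
Qed.

Fact ce_diffB n (f f' : ('I_n -> g) -> M) :
  ce_diff (f - f') = ce_diff f - ce_diff f'.
Proof.
have E v : (f - f') v = f v - f' v by [].
have E' v : (ce_diff f - ce_diff f') v = ce_diff f v - ce_diff f' v by [].
apply/funext => v; rewrite E' /ce_diff opprD addrACA; congr (_ + _).
  rewrite /ce_diff_act -sumrB; apply: eq_bigr => i _.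
  by rewrite E (raddfB (lact (v i))) scalerBr.
case: n f f' E {E'} v => [|n] f f' E v /=; first by rewrite subr0.
rewrite -sumrB; apply: eq_bigr => j _; rewrite -sumrB; apply: eq_bigr => i _.
by rewrite E scalerBr.
Qed.

Fact ce_diff0 n : ce_diff (0 : ('I_n -> g) -> M) = 0.
Proof. by rewrite -(subrr 0) ce_diffB subrr. Qed.

Fact cocycle_zmod_closed n : zmod_closed (cocycle_pred n).
Proof.
split=> [|f f' /asboolP[cf df] /asboolP[cf' df']]; apply/asboolP.
  by split; [exact: cochain0 | exact: ce_diff0].
by split; [exact: cochainB | rewrite ce_diffB df df' subrr].
Qed.

HB.instance Definition _ n :=
  GRing.isZmodClosed.Build _ (cocycle_pred n) (cocycle_zmod_closed n).
HB.instance Definition _ n := [SubChoice_isSubZmodule of cocycle n by <:].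

Definition is_coboundary n : (('I_n -> g) -> M) -> Prop :=
  match n with
  | 0 => fun z => z = 0
  | m.+1 => fun z => exists2 b : ('I_m -> g) -> M, cochain b & ce_diff b = z
  end.

Definition coboundary_pred n : {pred cocycle n} :=
  fun z => `[< is_coboundary (z : ('I_n -> g) -> M) >].

Arguments coboundary_pred n : clear implicits.

Fact coboundary_zmod_closed n : zmod_closed (coboundary_pred n).
Proof.
split=> [|z z' /asboolP bz /asboolP bz']; apply/asboolP.
  by case: n => [//|n]; exists 0; [exact: cochain0 | exact: ce_diff0].
case: n z z' bz bz' => [|n] z z' /=; first by move=> -> ->; rewrite subrr.
move=> [b cb db] [b' cb' db'].
by exists (b - b'); [exact: cochainB | rewrite ce_diffB db db'].
Qed.

HB.instance Definition _ n :=
  GRing.isZmodClosed.Build _ (coboundary_pred n) (coboundary_zmod_closed n).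

Definition cohomology n := Quotient.quot (coboundary_pred n).
HB.instance Definition _ n := GRing.Zmodule.on (cohomology n).

End ChevalleyEilenberg.

Arguments cocycle_pred {K g} M n : rename.
Arguments coboundary_pred {K g} M n : rename.

Section InducedMap.
Variables (K : fieldType) (g h : lieAlgType K) (phi : {lie g -> h}).
Variable M : lieModType h.

Definition pullback n (f : ('I_n -> h) -> M) : ('I_n -> g) -> restr phi M :=
  fun v => f (phi \o v).

Fact comp_dfwith n (v : 'I_n -> g) (i : 'I_n) x :
  phi \o dfwith v (i := i) x = dfwith (phi \o v) (i := i) (phi x).
Proof.
apply/funext => j /=; case: (eqVneq i j) => [<-|ij]; first by rewrite !dfwith_in.
by rewrite !dfwith_out.
Qed.

Fact pullback_cochain n (f : ('I_n -> h) -> M) :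
  cochain f -> cochain (pullback f).
Proof.
move=> [mf af]; split=> [v i a x y|v i j nij vij].
  by rewrite /pullback !comp_dfwith linearP; exact: mf.
by apply: (af _ i j) => //=; rewrite vij.
Qed.

Fact pullback_diff n (f : ('I_n -> h) -> M) :
  ce_diff (pullback f) = pullback (ce_diff f).
Proof.
apply/funext => v; congr (_ + _).
case: n f v => [|n] f v //=; apply: eq_bigr => j _; apply: eq_bigr => i _.
congr (_ *: f _); apply/funext => k; rewrite /fcons /=.
by case: unlift => //=; rewrite lie_morph.
Qed.

Fact cocycle_pullback_subproof n (z : cocycle M n) :
  pullback z \in cocycle_pred (restr phi M) n.
Proof.
case: z => z /= /asboolP[cz dz]; apply/asboolP; split.
  exact: pullback_cochain.
by rewrite pullback_diff dz.
Qed.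

Definition cocycle_pullback n (z : cocycle M n) : cocycle (restr phi M) n :=
  Cocycle (cocycle_pullback_subproof z).

Definition induced n (c : cohomology M n) : cohomology (restr phi M) n :=
  \pi_(cohomology (restr phi M) n)%qT (cocycle_pullback (repr c)).

Fact pullback_coboundary n (z : cocycle M n) :
  z \in coboundary_pred M n ->
  cocycle_pullback z \in coboundary_pred (restr phi M) n.
Proof.
move=> /asboolP bz; apply/asboolP; case: n z bz => [|n] z /=; first by move=> ->.
move=> [b cb db]; exists (pullback b); first exact: pullback_cochain.
by rewrite pullback_diff db.
Qed.

(* The induced map does not depend on the representative picked by repr. *)
Fact induced_pi n (z : cocycle M n) :
  induced (\pi_(cohomology M n)%qT z)
  = \pi_(cohomology (restr phi M) n)%qT (cocycle_pullback z).
Proof.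
apply/eqP; rewrite /induced -Quotient.idealrBE.
have -> : cocycle_pullback (repr (\pi_(cohomology M n)%qT z))
          - cocycle_pullback z
        = cocycle_pullback (repr (\pi_(cohomology M n)%qT z) - z).
  exact: val_inj.
by apply: pullback_coboundary; rewrite Quotient.idealrBE reprK.
Qed.

End InducedMap.

Local Open Scope classical_set_scope.
Local Open Scope ereal_scope.

(* Values in {0, 1, 2, ...} U {oo} are taken in the extended integers. *)
Section CohomologicalDimension.
Variable K : fieldType.

Definition cohomology_degrees (g : lieAlgType K) : set nat :=
  [set n | exists (M : lieModType g) (c : cohomology M n), c <> 0%R].

(* xget returns +oo when the set of maxima is empty. *)
Definition cd (g : lieAlgType K) : \bar int :=
  xget +oo [set n%:Z%:E | n in
    [set n | cohomology_degrees g n /\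
             forall m, cohomology_degrees g m -> (m <= n)%N]].

Definition induced_degrees (g h : lieAlgType K) (phi : {lie g -> h}) : set nat :=
  [set n | exists (M : lieModType h) (c : cohomology M n),
             induced phi c <> 0%R].

Definition cd_morph (g h : lieAlgType K) (phi : {lie g -> h}) : \bar int :=
  supremum 0 [set n%:Z%:E | n in induced_degrees phi].

End CohomologicalDimension.

(* Main.v *)
Require Import Defs.
From HB Require Import structures.
From mathcomp Require Import all_boot all_order all_algebra.
From mathcomp Require Import ring_quotient generic_quotient.
From mathcomp Require Import boolp classical_sets functions constructive_ereal.

(** The class of a cocycle is killed by [phi^*] exactly when its pullback is a
    coboundary, and neither cochains nor the differential see whether
    coefficients are restricted in one step or two, or along the identity.  Hence
    every degree detected by [psi \o phi] is detected by both [phi] and [psi],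
    every degree detected by [phi] is one in which both algebras have cohomology,
    and the identity detects all such degrees.  Taking suprema gives the three
    claims, since [cd g] is the supremum of the degrees with nonzero cohomology;
    that set is nonempty because [H^0] of the trivial module [K] is nonzero. *)

Set Implicit Arguments.
Unset Strict Implicit.
Unset Printing Implicit Defensive.

Import Order.TTheory GRing.Theory Num.Theory.
Local Open Scope classical_set_scope.

Definition degree_sup (D : set nat) : \bar int :=
  supremum 0%E [set n%:Z%:E | n in D].

Lemma ex_max_degree (D : set nat) (N : nat) :
  D !=set0 -> (forall n, D n -> (n <= N)%N) ->
  exists m, D m /\ forall n, D n -> (n <= m)%N.
Proof.
move=> [d Dd] DN.
have exD : exists n, `[< D n >] by exists d; apply/asboolP.
have ubD n : `[< D n >] -> (n <= N)%N by move=> /asboolP; exact: DN.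
case: (ex_maxnP exD ubD) => m /asboolP Dm mD.
by exists m; split=> // n Dn; apply/mD/asboolP.
Qed.

Lemma degree_sup_max (D : set nat) (m : nat) :
  D m -> (forall n, D n -> (n <= m)%N) -> degree_sup D = m%:Z%:E.
Proof.
move=> Dm mD; rewrite /degree_sup /supremum ifF; last first.
  by apply/negbTE/set0P; exists m%:Z%:E, m.
apply: xget_subset1; last exact: is_subset1_supremums.
split=> [_ [n Dn <-]|y]; first by rewrite lee_fin lez_nat mD.
by apply; exists m.
Qed.

Lemma degree_sup_unbounded (D : set nat) :
  ~ (exists N, forall n, D n -> (n <= N)%N) -> degree_sup D = +oo%E.
Proof.
move=> bndD; have unbD N : exists2 n, D n & (N < n)%N.
  apply: contrapT => DN; apply: bndD; exists N => n Dn.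
  by rewrite leqNgt; apply/negP => Nn; apply: DN; exists n.
 have [d Dd _] := unbD 0%N.
rewrite /degree_sup /supremum ifF; last first.
  by apply/negbTE/set0P; exists d%:Z%:E, d.
apply: xget_subset1; last exact: is_subset1_supremums.
split=> [_ [n Dn <-]|y uby]; first exact: leey.
case: y uby => [z||] // uby.
- have [n Dn zn] := unbD `|z|%N.
  have : (n%:Z%:E <= z%:E)%E by apply: uby; exists n.
  rewrite lee_fin => /le_trans/(_ (ler_norm z)).
  by rewrite -abszE lez_nat leqNgt zn.
- by have := uby d%:Z%:E (ex_intro2 _ _ _ Dd erefl).
Qed.

Lemma degree_sup_ub (D : set nat) (n : nat) : D n -> (n%:Z%:E <= degree_sup D)%E.
Proof.
move=> Dn; have [[N DN]|unbD] := pselect (exists N, forall k, D k -> (k <= N)%N).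
  have [m [Dm mD]] := ex_max_degree (ex_intro _ n Dn) DN.
  by rewrite (degree_sup_max Dm mD) lee_fin lez_nat mD.
by rewrite degree_sup_unbounded ?leey.
Qed.

Lemma degree_sup_le (D : set nat) (b : \bar int) :
  (0 <= b)%E -> (forall n, D n -> (n%:Z%:E <= b)%E) -> (degree_sup D <= b)%E.
Proof.
move=> b0 Db; have [->|/set0P[d Dd]] := eqVneq D set0.
  by rewrite /degree_sup image_set0 supremum0.
have [[N DN]|unbD] := pselect (exists N, forall k, D k -> (k <= N)%N).
  have [m [Dm mD]] := ex_max_degree (ex_intro _ d Dd) DN.
  by rewrite (degree_sup_max Dm mD) Db.
case: b b0 Db => [z z0 Db|_ _|//]; last exact: leey.
case: unbD; exists `|z|%N => k /Db; rewrite lee_fin => kz.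
by rewrite -lez_nat gez0_abs // -lee_fin.
Qed.

Lemma degree_sup_ge0 (D : set nat) : (0 <= degree_sup D)%E.
Proof.
have [->|/set0P[d Dd]] := eqVneq D set0.
  by rewrite /degree_sup image_set0 supremum0.
by apply: le_trans (degree_sup_ub Dd); rewrite lee_fin.
Qed.

Lemma degree_sup_subset (D D' : set nat) :
  D `<=` D' -> (degree_sup D <= degree_sup D')%E.
Proof.
move=> DD'; apply: degree_sup_le => [|n /DD']; first exact: degree_sup_ge0.
exact: degree_sup_ub.
Qed.

Section Cohomology.
Variable K : fieldType.
Local Open Scope ring_scope.

Lemma pi_cohomology_eq0 (g : lieAlgType K) (M : lieModType g) (n : nat)
    (z : cocycle M n) :
  \pi_(cohomology M n)%qT z = 0 <-> is_coboundary (cocycle_fun z).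
Proof.
have <- : \pi_(cohomology M n)%qT (0 : cocycle M n) = 0.
  exact: pi_zeror.
split=> [/eqP|zb]; first by rewrite -Quotient.idealrBE subr0 => /asboolP.
by apply/eqP; rewrite -Quotient.idealrBE subr0; apply/asboolP.
Qed.

Lemma induced_eq0 (g h : lieAlgType K) (phi : {lie g -> h}) (M : lieModType h)
    (n : nat) (z : cocycle M n) :
  induced phi (\pi_(cohomology M n)%qT z) = 0
  <-> is_coboundary (pullback phi (cocycle_fun z)).
Proof. by rewrite induced_pi; exact: pi_cohomology_eq0. Qed.

Lemma induced0 (g h : lieAlgType K) (phi : {lie g -> h}) (M : lieModType h)
    (n : nat) : induced phi (0 : cohomology M n) = 0.
Proof.
have z0 : is_coboundary (cocycle_fun (0 : cocycle M n)).
  exact/asboolP/(rpred0 (coboundary_pred M n)).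
rewrite -((pi_cohomology_eq0 _).2 z0) induced_pi.
by apply/pi_cohomology_eq0/asboolP/pullback_coboundary/asboolP.
Qed.

Lemma induced_degrees_sub_domain (g h : lieAlgType K) (phi : {lie g -> h}) :
  induced_degrees phi `<=` cohomology_degrees g.
Proof. by move=> n [M [c c0]]; exists (restr phi M), (induced phi c). Qed.

Lemma induced_degrees_sub_codomain (g h : lieAlgType K) (phi : {lie g -> h}) :
  induced_degrees phi `<=` cohomology_degrees h.
Proof. by move=> n [M [c c0]]; exists M, c => cE; apply: c0; rewrite cE induced0. Qed.

Lemma induced_idfun_eq0 (g : lieAlgType K) (M : lieModType g) (n : nat)
    (c : cohomology M n) :
  induced (idfun : {lie g -> g}) c = 0 -> c = 0.
Proof.
elim/quotW: c => z /induced_eq0 zb; apply/pi_cohomology_eq0.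
by case: n z zb.
Qed.

Lemma induced_comp_eq0 (g h l : lieAlgType K) (phi : {lie g -> h})
    (psi : {lie h -> l}) (M : lieModType l) (n : nat) (c : cohomology M n) :
  induced phi (induced psi c) = 0 ->
  induced (psi \o phi : {lie g -> l}) c = 0.
Proof.
elim/quotW: c => z; rewrite (induced_pi psi) => /induced_eq0 zb; apply/induced_eq0.
by case: n z zb.
Qed.

Lemma induced_degrees_idfun (g : lieAlgType K) :
  induced_degrees (idfun : {lie g -> g}) = cohomology_degrees g.
Proof.
apply/seteqP; split; first exact: induced_degrees_sub_domain.
by move=> n [M [c c0]]; exists M, c => /induced_idfun_eq0.
Qed.

Lemma induced_degrees_comp_left (g h l : lieAlgType K) (phi : {lie g -> h})
    (psi : {lie h -> l}) :
  induced_degrees (psi \o phi : {lie g -> l}) `<=` induced_degrees phi.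
Proof.
by move=> n [M [c c0]]; exists (restr psi M), (induced psi c) => /induced_comp_eq0.
Qed.

Lemma induced_degrees_comp_right (g h l : lieAlgType K) (phi : {lie g -> h})
    (psi : {lie h -> l}) :
  induced_degrees (psi \o phi : {lie g -> l}) `<=` induced_degrees psi.
Proof.
move=> n [M [c c0]]; exists M, c => cE; apply: c0.
by apply: induced_comp_eq0; rewrite cE induced0.
Qed.

Section TrivialModule.
Variable g : lieAlgType K.

Definition triv_mod : Type := K^o.
HB.instance Definition _ := GRing.Lmodule.copy triv_mod K^o.

Definition triv_act (x : g) (m : triv_mod) : triv_mod := 0.

Fact triv_act_linearl m : linear (triv_act^~ m).
Proof. by move=> a x y; rewrite /triv_act scaler0 addr0. Qed.

Fact triv_act_linearr x : linear (triv_act x).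
Proof. by move=> a m m'; rewrite /triv_act scaler0 addr0. Qed.

Fact triv_act_lie x y m :
  triv_act (lie x y) m = triv_act x (triv_act y m) - triv_act y (triv_act x m).
Proof. by rewrite /triv_act subr0. Qed.

HB.instance Definition _ := isLieModule.Build K g triv_mod
  triv_act_linearl triv_act_linearr triv_act_lie.

Lemma cohomology_degrees0 : cohomology_degrees g 0%N.
Proof.
pose f : ('I_0 -> g) -> triv_mod := fun=> (1 : K).
have fP : f \in cocycle_pred (triv_mod : lieModType g) 0.
  apply/asboolP; split; first by split=> [v []|v []].
  apply/funext => v; rewrite /ce_diff /ce_diff_act /= big1 ?addr0// => i _.
  exact: scaler0.
exists (triv_mod : lieModType g), (\pi_(cohomology _ 0)%qT (Cocycle fP)).
move=> /pi_cohomology_eq0 /= /(congr1 (fun F => F (fun=> 0))) /eqP.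
by apply/negP/oner_neq0.
Qed.

End TrivialModule.

(* [cd] falls back to [+oo] and [cd_morph] to [0] on the empty set of degrees,
   so nonemptiness is essential here. *)
Lemma cd_degree_sup (g : lieAlgType K) : cd g = degree_sup (cohomology_degrees g).
Proof.
set D := cohomology_degrees g.
have [[N DN]|unbD] := pselect (exists N, forall k, D k -> (k <= N)%N).
  have [m [Dm mD]] := ex_max_degree (ex_intro _ 0%N (cohomology_degrees0 g)) DN.
  rewrite (degree_sup_max Dm mD); apply: xget_unique; first by exists m.
  by move=> _ [k [Dk kD] <-]; congr (_%:Z%:E); apply/eqP; rewrite eqn_leq mD// kD.
rewrite degree_sup_unbounded //.
by apply: xgetPN => _ [m [_ mD] _]; apply: unbD; exists m.
Qed.

End Cohomology.

Theorem proposition3p2 (K : fieldType) (g h l : lieAlgType K)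
    (phi : {lie g -> h}) (psi : {lie h -> l}) :
  [/\ (cd_morph phi <= Order.min (cd g) (cd h))%E,
      cd_morph (idfun : {lie g -> g}) = cd g
    & (cd_morph (psi \o phi : {lie g -> l})
        <= Order.min (cd_morph phi) (cd_morph psi))%E].
Proof.
split.
- rewrite le_min !cd_degree_sup; apply/andP; split; apply: degree_sup_subset.
    exact: induced_degrees_sub_domain.
  exact: induced_degrees_sub_codomain.
- by rewrite cd_degree_sup /cd_morph induced_degrees_idfun.
- rewrite le_min; apply/andP; split; apply: degree_sup_subset.
    exact: induced_degrees_comp_left.
  exact: induced_degrees_comp_right.
Qed.
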